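(* Let $H$ be a finite dimensional semisimple Hopf algebra over a field $\mathbf{k}$, and let $e\in H$ be a left integral of $H$ with $\varepsilon(e)=1$. Let $A$ be a left $H$-module and define $T:A\to A$ by $T(a)=e\cdot a$. Then $(A,T)$ is a generic Rota-Baxter paired $H$-module of weight $-1$.
   Context: A left integral of a bialgebra $H$ with counit $\varepsilon$ is an element $x\in H$ with $hx=\varepsilon(h)x$ for all $h\in H$. For a finite dimensional semisimple Hopf algebra, a left integral $e$ with $\varepsilon(e)=1$ exists. For an algebra $B$ over $\mathbf{k}$, a left $B$-module $M$ and $\mathbf{k}$-linear maps $P:B\to B$, $T:M\to M$, the triple $(M,P,T)$ is a Rota-Baxter paired $B$-module of weight $\lambda\in\mathbf{k}$ if $$P(b)\cdot T(m)=T(P(b)\cdot m)+T(b\cdot T(m))+\lambda T(b\cdot m)\quad\text{for all } b\in B,\ m\in M.$$ The pair $(M,T)$ is a generic Rota-Baxter paired $B$-module of weight $\lambda$ if $(M,P,T)$ is a Rota-Baxter paired $B$-module of weight $\lambda$ for every $\mathbf{k}$-linear map $P:B\to B$. *)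

(* Defs.v *)
From HB Require Import structures.
From mathcomp Require Import all_boot all_algebra all_field.
Set Implicit Arguments.
Unset Strict Implicit.
Unset Printing Implicit Defensive.
Import GRing.Theory.
Local Open Scope ring_scope.

(* U (x) V for finite dimensional U and V, in coordinates: the entry (i, j) of
   a tensor is its coefficient on (i-th basis vector of U) (x) (j-th basis
   vector of V). Only the vector space structure of matrices is kept; the
   matrix product is not the product of H (x) H. *)
Definition tensor (k : fieldType) (U V : vectType k) : Type :=
  'M[k]_(\dim {:U}, \dim {:V}).

HB.instance Definition _ (k : fieldType) (U V : vectType k) :=
  Vector.on (tensor U V).

Definition pure_tensor (k : fieldType) (U V : vectType k) (u : U) (v : V) :
    tensor U V :=
  \matrix_(i, j) (coord (vbasis {:U}) i u * coord (vbasis {:V}) j v).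

Notation "u '⊗' v" := (pure_tensor u v) (at level 40, left associativity).

(* The linear map U (x) V -> W induced by a bilinear map f. *)
Definition tensor_lift (k : fieldType) (U V : vectType k) (W : lmodType k)
    (f : U -> V -> W) (t : tensor U V) : W :=
  \sum_i \sum_j t i j *: f (vbasis {:U})`_i (vbasis {:V})`_j.

Lemma tensor_lift_is_linear (k : fieldType) (U V : vectType k)
    (W : lmodType k) (f : U -> V -> W) : linear (tensor_lift f).
Proof.
move=> c s t; rewrite /tensor_lift scaler_sumr -big_split /=.
apply: eq_bigr => i _; rewrite scaler_sumr -big_split /=.
by apply: eq_bigr => j _; rewrite !mxE scalerDl scalerA.
Qed.

(* The existence half of the universal property. *)
Lemma tensor_lift_pure (k : fieldType) (U V : vectType k) (W : lmodType k)
    (f : U -> V -> W) (u : U) (v : V) :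
    (forall x, linear (f x)) -> (forall y, linear (f^~ y)) ->
  tensor_lift f (u ⊗ v) = f u v.
Proof.
move=> fr fl; rewrite /tensor_lift.
have f0l y : f 0 y = 0.
  by have := fl y (-1) 0 0; rewrite scaler0 addr0 scaleN1r addNr.
have f0r x : f x 0 = 0.
  by have := fr x (-1) 0 0; rewrite scaler0 addr0 scaleN1r addNr.
have suml I (r : seq I) (a : I -> k) (x : I -> U) y :
    f (\sum_(i <- r) a i *: x i) y = \sum_(i <- r) a i *: f (x i) y.
  by elim: r => [|i r IHr]; rewrite ?big_nil ?f0l // !big_cons fl IHr.
have sumr I (r : seq I) (a : I -> k) x (y : I -> V) :
    f x (\sum_(i <- r) a i *: y i) = \sum_(i <- r) a i *: f x (y i).
  by elim: r => [|i r IHr]; rewrite ?big_nil ?f0r // !big_cons fr IHr.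
rewrite [in RHS](coord_vbasis (memvf u)) [in RHS](coord_vbasis (memvf v)) suml.
apply: eq_bigr => i _; rewrite sumr scaler_sumr.
by apply: eq_bigr => j _; rewrite mxE scalerA.
Qed.

(* The uniqueness half of the universal property. *)
Lemma tensor_sum_pure (k : fieldType) (U V : vectType k) (t : tensor U V) :
  t = \sum_i \sum_j t i j *: ((vbasis {:U})`_i ⊗ (vbasis {:V})`_j).
Proof.
apply/matrixP => a b; rewrite summxE (bigD1 a) //= summxE (bigD1 b) //=.
have coordE (W : vectType k) (i j : 'I_(\dim {:W})) :
    coord (vbasis {:W}) i (vbasis {:W})`_j = (i == j)%:R.
  by rewrite coord_free ?(basis_free (vbasisP _)) 1?eq_sym.
rewrite !mxE !coordE !eqxx !mulr1 big1 ?addr0 => [|j /negPf neq_jb]; last first.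
  by rewrite !mxE !coordE [b == j]eq_sym neq_jb !mulr0.
rewrite big1 ?addr0 // => i /negPf neq_ia; rewrite summxE big1 // => j _.
by rewrite !mxE !coordE [a == i]eq_sym neq_ia mul0r mulr0.
Qed.

Definition tensor_map (k : fieldType) (U V U' V' : vectType k)
    (f : U -> U') (g : V -> V') : tensor U V -> tensor U' V' :=
  tensor_lift (fun u v => f u ⊗ g v).

Definition tensor_assoc (k : fieldType) (U V W : vectType k) :
    tensor (tensor U V) W -> tensor U (tensor V W) :=
  tensor_lift (fun t w => tensor_lift (fun u v => u ⊗ (v ⊗ w)) t).

Definition tensor_mul (k : fieldType) (H : falgType k) (s t : tensor H H) :
    tensor H H :=
  tensor_lift (fun a b => tensor_lift (fun c d => (a * c) ⊗ (b * d)) t) s.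

(* Being an {lrmorphism _ -> _}, the counit is a unital algebra map. *)
Record bialgebra (k : fieldType) (H : falgType k) := Bialgebra {
  comul : {linear H -> tensor H H};
  counit : {lrmorphism H -> k^o};
  comul_coassoc : forall h,
    tensor_assoc (tensor_map comul id (comul h))
      = tensor_map id comul (comul h);
  counit_comul_l : forall h,
    tensor_lift (fun a b => (counit a : k) *: b) (comul h) = h;
  counit_comul_r : forall h,
    tensor_lift (fun a b => (counit b : k) *: a) (comul h) = h;
  comul1 : comul 1 = 1 ⊗ 1;
  comulM : forall g h, comul (g * h) = tensor_mul (comul g) (comul h)
}.

Record hopf_algebra (k : fieldType) (H : falgType k) := HopfAlgebra {
  hopf_bialgebra :> bialgebra H;
  antipode : {linear H -> H};
  antipode_l : forall h,
    tensor_lift (fun a b => antipode a * b) (comul hopf_bialgebra h)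
      = (counit hopf_bialgebra h : k)%:A;
  antipode_r : forall h,
    tensor_lift (fun a b => a * antipode b) (comul hopf_bialgebra h)
      = (counit hopf_bialgebra h : k)%:A
}.

Definition left_integral (k : fieldType) (H : falgType k) (B : bialgebra H)
    (x : H) : Prop :=
  forall h : H, h * x = (counit B h : k) *: x.

Definition left_ideal (k : fieldType) (H : falgType k) (I : {vspace H}) :
    Prop :=
  forall h x : H, x \in I -> h * x \in I.

Definition minimal_left_ideal (k : fieldType) (H : falgType k)
    (I : {vspace H}) : Prop :=
  [/\ left_ideal I, I != 0%VS
    & forall J : {vspace H}, left_ideal J -> (J <= I)%VS ->
        J = 0%VS \/ J = I].

(* The regular left module is a finite direct sum of simple submodules. *)
Definition semisimple_algebra (k : fieldType) (H : falgType k) : Prop :=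
  exists (n : nat) (I : 'I_n -> {vspace H}),
    [/\ forall i, minimal_left_ideal (I i),
        directv (\sum_i I i)
      & (\sum_i I i)%VS = {:H}%VS].

(* A module over a k-algebra B is a k-vector space through c |-> c%:A. *)
Definition klinear (k : fieldType) (B : algType k) (M : lmodType B)
    (T : M -> M) : Prop :=
  forall (c : k) (m n : M),
    T ((c%:A : B) *: m + n) = (c%:A : B) *: T m + T n.

Definition rota_baxter_paired_module (k : fieldType) (B : algType k)
    (M : lmodType B) (P : {linear B -> B}) (T : M -> M) (lambda : k) : Prop :=
  klinear T /\
  forall (b : B) (m : M),
    P b *: T m = T (P b *: m) + T (b *: T m) + (lambda%:A : B) *: T (b *: m).

Definition generic_rota_baxter_paired_module (k : fieldType) (B : algType k)
    (M : lmodType B) (T : M -> M) (lambda : k) : Prop :=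
  forall P : {linear B -> B}, rota_baxter_paired_module P T lambda.

(* Main.v *)
(** Applied to the module, the Rota-Baxter identity is an identity in [H] that
    holds as soon as [e] is also a right integral. For every [h] the element
    [x = e h - eps(h) e] is a left integral with [eps(x) = 0], so [x x = 0].
    Left multiplication by [x] maps each minimal left ideal [I] onto a left
    ideal contained in [I]; since [x x = 0] it cannot be [I], so it is [0]. As
    [H] is a sum of minimal left ideals, [x = 0]. *)
Require Import Defs.
From mathcomp Require Import all_boot all_algebra all_field.
Import GRing.Theory.
Local Open Scope ring_scope.

Lemma left_integral_counit0 (k : fieldType) (H : falgType k) (B : bialgebra H)
    (x : H) :
  semisimple_algebra H -> left_integral B x -> counit B x = 0 :> k -> x = 0.
Proof.
move=> [n [I [minI _ sumI]]] int_x eps_x.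
have xx0 : x * x = 0 by rewrite int_x eps_x scale0r.
have xI0 i y : y \in I i -> x * y = 0.
  move=> Iy; have [idI _ minIi] := minI i.
  pose J := (amull x @: I i)%VS.
  have idJ : left_ideal J.
    (* Since [x] is a left integral, [h] only rescales [x * z]. *)
    move=> h _ /memv_imgP[z Iz ->]; rewrite lfunE /= mulrA int_x -scalerAl.
    by rewrite memvZ //; apply/memv_imgP; exists z; rewrite ?lfunE.
  have JI : (J <= I i)%VS.
    by apply/subvP=> _ /memv_imgP[z Iz ->]; rewrite lfunE /=; apply: idI.
  have Jxy : x * y \in J by apply/memv_imgP; exists y; rewrite ?lfunE.
  case: (minIi J idJ JI) => [J0 | eqJI]; first by apply/eqP; rewrite -memv0 -J0.
  move: Iy; rewrite -eqJI => /memv_imgP[z _ ->].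
  by rewrite lfunE /= mulrA xx0 mul0r.
have : 1 \in (\sum_i I i)%VS by rewrite sumI memvf.
case/memv_sumP => v Iv def1; rewrite -[x]mulr1 def1 mulr_sumr big1 // => i _.
by rewrite (xI0 i) ?Iv.
Qed.

Lemma left_integral_mulr (k : fieldType) (H : falgType k) (B : bialgebra H)
    (e : H) :
  semisimple_algebra H -> left_integral B e -> counit B e = 1 :> k ->
  forall h, e * h = (counit B h : k) *: e.
Proof.
move=> ssH int_e eps_e h; apply/eqP; rewrite -subr_eq0; apply/eqP.
apply: (left_integral_counit0 _ _ B) => // [g|].
  rewrite mulrBr mulrA int_e -scalerAl -scalerAr int_e scalerBr.
  by rewrite !scalerA [_ * counit B h]mulrC.
rewrite raddfB /= rmorphM linearZ /= eps_e mul1r.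
(* Scaling in [k^o] is multiplication in [k], so [mulr1] applies to it. *)
by rewrite [_ *: _]mulr1 subrr.
Qed.

Theorem corollary3p2 (k : fieldType) (H : falgType k) (hopfH : hopf_algebra H)
    (ssH : semisimple_algebra H) (e : H) (int_e : left_integral hopfH e)
    (eps_e : counit hopfH e = 1 :> k) (A : lmodType H) :
  generic_rota_baxter_paired_module (fun a : A => e *: a) (-1 : k).
Proof.
move=> P; split=> [c m n | b m].
  by rewrite scalerDr !scalerA -scalerAr mulr1 -scalerAl mul1r.
have mulr_e := left_integral_mulr _ _ _ _ ssH int_e eps_e.
(* What remains is an identity in [H]. Both terms in [P b] equal [e] scaled by the counit of [P b],
   so [P] can be arbitrary; the two terms in [b] alone are that of [b] times [e], with opposite
   signs, and cancel. *)
rewrite !scalerA -!scalerDl; congr (_ *: _).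
by rewrite scaleN1r mulN1r mulNr !int_e rmorphM /= eps_e mul1r !mulr_e addrK.
Qed.
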